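(* Let $(A,m)$ be an associative algebra over a field $k$ of characteristic zero, and let $m_1\in C_2=\mathrm{Hom}_k(A^{\otimes 2},A)$ satisfy $\partial m_1=0$. Let $\mathcal D\subset Z_3=\ker(\partial: C_3\to C_4)$ be a linear subspace and let $\sigma:\mathcal D\to C_2$ be a linear map such that $\partial\sigma(z)+\sigma(\partial z)=z$ for all $z\in\mathcal D$ (an almost contraction in degree three; here $\partial z=0$, so $\sigma(\partial z)=\sigma(0)=0$). Suppose that, setting inductively for $n\ge 2$ $$D_n=-\frac12\sum_{i,j\ge 1,\ i+j=n}[m_i,m_j],\qquad m_n=\sigma(D_n),$$ the subspace $\mathcal D$ contains $D_n$ for all $n\ge 2$. Then $$u\star v=m(u,v)+\sum_{n\ge 1}\hbar^n m_n(u,v)$$ defines an associative $k[[\hbar]]$-bilinear product on $A[[\hbar]]$.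
   Context: For $n\ge 1$, $C_n=\mathrm{Hom}_k(A^{\otimes n},A)$ denotes the Hochschild cochains, with the Gerstenhaber composition $f\circ g=\sum_{i=1}^{p}(-1)^{(i-1)(q-1)}f\circ_i g\in C_{p+q-1}$ for $f\in C_p$, $g\in C_q$, where $f\circ_i g$ inserts $g$ in the $i$-th argument of $f$. The graded Lie bracket is $[f,g]=f\circ g-(-1)^{(p-1)(q-1)}g\circ f$, so that elements of $C_2$ have (shifted) degree one and $[f,g]=f\circ g+g\circ f$ for $f,g\in C_2$. The differential is $\partial=[m,\cdot\,]:C_n\to C_{n+1}$, which squares to zero because $m$ is associative. The product $\star$ is extended from $A$ to $A[[\hbar]]$ by $k[[\hbar]]$-bilinearity. *)

(* Defs.v *)
From HB Require Import structures.
From mathcomp Require Import all_boot all_order all_algebra.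
From mathcomp Require Import boolp classical_sets functions.
From mathcomp Require Import zify.

Set Implicit Arguments.
Unset Strict Implicit.
Unset Printing Implicit Defensive.

Import GRing.Theory.
Local Open Scope ring_scope.

(* Hochschild cochains.  Hom_k(A^{(x) n}, A) is the type of k-multilinear maps
   A^n -> A, the arguments being given as an n-tuple.                        *)

Definition tuple_set (T : Type) (n : nat) (x : n.-tuple T) (i : 'I_n) (u : T) :
  n.-tuple T := [tuple if j == i then u else tnth x j | j < n].

Section Cochains.
Variables (k : fieldType) (A : lmodType k).

Definition multilinear (n : nat) : {pred n.-tuple A -> A} :=
  fun f => `[< forall (x : n.-tuple A) (i : 'I_n),
                 linear (fun u => f (tuple_set x i u)) >].

Lemma multilinearP n (f : n.-tuple A -> A) :
  reflect (forall x i, linear (fun u => f (tuple_set x i u)))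
          (f \in @multilinear n).
Proof. exact: asboolP. Qed.

Lemma multilinear_submod_closed n : submod_closed (@multilinear n).
Proof.
split=> [|a f g /multilinearP fL /multilinearP gL]; apply/multilinearP => x i b u v.
  by rewrite /GRing.zero /= scaler0 addr0.
have E y : (a *: f + g) y = a *: f y + g y by [].
by rewrite !E fL gL !scalerDr !scalerA [a * b]mulrC addrACA.
Qed.

HB.instance Definition _ n := GRing.isSubmodClosed.Build k (n.-tuple A -> A)
  (@multilinear n) (multilinear_submod_closed n).

Record cochain (n : nat) := Cochain {
  cochain_fun :> n.-tuple A -> A;
  cochain_multilinear : cochain_fun \in @multilinear n
}.
HB.instance Definition _ n := [isSub for @cochain_fun n].
HB.instance Definition _ n := [Choice of cochain n by <:].
HB.instance Definition _ n := [SubChoice_isSubLmodule of cochain n by <:].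

Lemma cochainP n (f g : cochain n) : f =1 g -> f = g.
Proof. by move=> fg; apply/val_inj/funext. Qed.

(* f \o_i g : g is inserted in the slot i of f.  Slots are numbered from 0,
   so that this is f \o_(i+1) g when slots are numbered from 1.             *)
Definition insert_args p q (i : 'I_p) (g : q.-tuple A -> A)
    (x : (p + q).-1.-tuple A) : p.-tuple A :=
  [tuple if (j < i)%N then x`_j
         else if j == i then g [tuple x`_(i + l) | l < q]
         else x`_(j + q).-1 | j < p].

Definition circ_at_fun p q (f : p.-tuple A -> A) (i : 'I_p)
    (g : q.-tuple A -> A) (x : (p + q).-1.-tuple A) : A :=
  f (insert_args i g x).

Lemma nth_tuple_set n (x : n.-tuple A) s u t :
  (tuple_set x s u)`_t = if t == s :> nat then u else x`_t.
Proof.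
have [tn|nt] := ltnP t n; last first.
  rewrite !nth_default ?size_tuple //; case: eqP => // E.
  by have := ltn_ord s; rewrite -E ltnNge nt.
by rewrite -(tnth_nth 0 _ (Ordinal tn)) tnth_mktuple -val_eqE /= (tnth_nth 0).
Qed.

Lemma eq_linear (U V : lmodType k) (f g : U -> V) : f =1 g -> linear g -> linear f.
Proof. by move=> fg gL a u v; rewrite !fg gL. Qed.

Lemma circ_at_multilinear p q (f : cochain p) (i : 'I_p) (g : cochain q) :
  circ_at_fun f i g \in @multilinear (p + q).-1.
Proof.
have /multilinearP fL := cochain_multilinear f.
have /multilinearP gL := cochain_multilinear g.
apply/multilinearP => x s.
have := ltn_ord s; have := ltn_ord i; move=> ip spq.
have [si|is_] := ltnP s i.
  apply: eq_linear (fL (insert_args i g x) (Ordinal (ltn_trans si ip))) => u.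
  congr (cochain_fun f _); apply: eq_from_tnth => j.
  rewrite !tnth_mktuple -!val_eqE /= !nth_tuple_set.
  case: ltnP => ji; first by [].
  have /negbTE-> : (j != s :> nat)%N by lia.
  case: eqP => [_|/eqP nji].
    congr (cochain_fun g _); apply: eq_from_tnth => l.
    by rewrite !tnth_mktuple nth_tuple_set; case: eqP => //; lia.
  by have /negbTE-> : ((j + q).-1 != s)%N by lia.
have [siq|iqs] := ltnP s (i + q).
  have sq : (s - i < q)%N by lia.
  pose h u := g (tuple_set [tuple x`_(i + l) | l < q] (Ordinal sq) u).
  have hL : linear h by exact: gL.
  apply: eq_linear (_ : linear (fun u => f (tuple_set (insert_args i g x) i (h u)))).
    move=> u; congr (cochain_fun f _); apply: eq_from_tnth => j.
    rewrite !tnth_mktuple -!val_eqE /= !nth_tuple_set.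
    case: ltnP => ji.
      have /negbTE-> : (j != s :> nat)%N by lia.
      by have /negbTE-> : (j != i :> nat)%N by lia.
    case: eqP => [_|/eqP nji].
      congr (cochain_fun g _); apply: eq_from_tnth => l.
      rewrite !tnth_mktuple nth_tuple_set -val_eqE /=.
      by have -> : (i + l == s)%N = (l == s - i :> nat)%N by lia.
    by have /negbTE-> : ((j + q).-1 != s)%N by lia.
  by move=> a u v; rewrite hL fL.
have sp : (s.+1 - q < p)%N by lia.
apply: eq_linear (fL (insert_args i g x) (Ordinal sp)) => u.
congr (cochain_fun f _); apply: eq_from_tnth => j.
rewrite !tnth_mktuple -!val_eqE /= !nth_tuple_set.
case: ltnP => ji.
  have /negbTE-> : (j != s :> nat)%N by lia.
  by have /negbTE-> : (j != s.+1 - q :> nat)%N by lia.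
case: eqP => [jiE|/eqP nji].
  have /negbTE-> : (j != s.+1 - q :> nat)%N by lia.
  congr (cochain_fun g _); apply: eq_from_tnth => l.
  rewrite !tnth_mktuple nth_tuple_set.
  by have := ltn_ord l; case: eqP => //; lia.
by have -> : ((j + q).-1 == s)%N = (j == s.+1 - q :> nat)%N by lia.
Qed.

Definition circ_at p q (f : cochain p) (i : 'I_p) (g : cochain q) :
  cochain (p + q).-1 := Cochain (circ_at_multilinear f i g).

Definition circ p q (f : cochain p) (g : cochain q) : cochain (p + q).-1 :=
  \sum_(i < p) (-1) ^+ (i * q.-1) *: circ_at f i g.

(* The ecast only transports circ g f along (q + p).-1 = (p + q).-1. *)
Definition bracket p q (f : cochain p) (g : cochain q) : cochain (p + q).-1 :=
  circ f g - (-1) ^+ (p.-1 * q.-1) *: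
    ecast n (cochain n.-1) (addnC q p) (circ g f).

(* (2 + n).-1 and n.+1 are convertible. *)
Definition hdiff (m : cochain 2) n (f : cochain n) : cochain n.+1 :=
  bracket m f.

Definition obstruction (mu : nat -> cochain 2) (n : nat) : cochain 3 :=
  - 2^-1 *: \sum_(1 <= i < n) bracket (mu i) (mu (n - i)%N).

End Cochains.

Lemma bracket2E (k : fieldType) (A : lmodType k) (f g : cochain A 2) :
  bracket f g = circ f g + circ g f.
Proof.
by rewrite /bracket (eq_axiomK (addnC 2 2)) /= expr1 scaleN1r opprK.
Qed.

(* Formal power series sum_n u_n h^n with coefficients in V, as sequences
   (u_n)_n, with the ring structure of k[[h]] (Cauchy product) and the
   k[[h]]-module structure of V[[h]].                                     *)
Definition fps (V : Type) := nat -> V.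

HB.instance Definition _ (V : choiceType) := Choice.copy (fps V) (nat -> V).
HB.instance Definition _ (V : zmodType) := GRing.Zmodule.copy (fps V) (nat -> V).

Definition fps_const (V : zmodType) (u : V) : fps V :=
  fun n => if n is 0 then u else 0.

Section FpsModule.
Variables (R : comNzRingType) (V : lmodType R).
Implicit Types (a b : fps R) (u v : fps V).

Definition fps_mul a b : fps R := fun n => \sum_(i < n.+1) a i * b (n - i)%N.
Definition fps_scale a v : fps V := fun n => \sum_(i < n.+1) a i *: v (n - i)%N.

Lemma fps_scaleDr a u v : fps_scale a (u + v) = fps_scale a u + fps_scale a v.
Proof.
by apply/funext => n; rewrite -[RHS]big_split /=; apply: eq_bigr => i _; rewrite -scalerDr.
Qed.

Lemma fps_scaleDl v a b : fps_scale (a + b) v = fps_scale a v + fps_scale b v.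
Proof.
by apply/funext => n; rewrite -[RHS]big_split /=; apply: eq_bigr => i _; rewrite -scalerDl.
Qed.

Lemma fps_scale1 v : fps_scale (fps_const 1) v = v.
Proof.
apply/funext => n; rewrite /fps_scale big_ord_recl /= scale1r subn0 big1 ?addr0 //.
by move=> i _; rewrite scale0r.
Qed.

Lemma fps_scaleA a b v : fps_scale a (fps_scale b v) = fps_scale (fps_mul a b) v.
Proof.
apply/funext => n; rewrite /fps_scale /fps_mul.
pose c i m := a i *: (b (m - i)%N *: v (n - m)%N).
transitivity (\sum_(i < n.+1) \sum_(m < n.+1 | (i <= m)%N) c i m).
  apply: eq_bigr => i _; rewrite scaler_sumr.
  rewrite -(big_mkord (fun j => true) (fun j => a i *: (b j *: v (n - i - j)%N))).
  rewrite -(big_mkord (fun m => i <= m)%N (c i)).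
  rewrite (@big_cat_nat _ _ _ i 0 n.+1) //=; last exact/ltnW.
  rewrite [X in X + _]big_nat_cond [X in X + _]big1 ?add0r; last by move=> ?; lia.
  transitivity (\sum_(0 + i <= m < n.+1 | (i <= m)%N) c i m); last by rewrite add0n.
  rewrite big_addn subSn -1?ltnS //.
  rewrite [RHS]big_nat_cond [LHS]big_nat_cond.
  apply: eq_big => [j|j _]; first by lia.
  by rewrite /c addnK -subnDA [(j + i)%N]addnC.
rewrite (exchange_big_dep predT) //=; apply: eq_bigr => m _.
have mn : (m <= n)%N by rewrite -ltnS.
rewrite scaler_suml (big_ord_narrow_leq mn).
by apply: eq_bigr => i _; rewrite /c scalerA.
Qed.
End FpsModule.

Section FpsRing.
Variable R : comNzRingType.
Implicit Types a b : fps R.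

Lemma fps_mulC : commutative (@fps_mul R).
Proof.
move=> a b; apply/funext => n; rewrite /fps_mul (reindex_inj rev_ord_inj) /=.
by apply: eq_bigr => i _; rewrite subSS subKn 1?mulrC // -ltnS.
Qed.

Lemma fps_mulA : associative (@fps_mul R).
Proof. move=> a b c; exact: (@fps_scaleA R R^o). Qed.

Lemma fps_mul1 : left_id (fps_const 1) (@fps_mul R).
Proof. exact: (@fps_scale1 R R^o). Qed.

Lemma fps_mulDl : left_distributive (@fps_mul R) +%R.
Proof. move=> a b c; exact: (@fps_scaleDl R R^o). Qed.

Lemma fps_oner_neq0 : fps_const (1 : R) != 0.
Proof. by apply/eqP => /(congr1 (@^~ 0%N)) /eqP; rewrite /= oner_eq0. Qed.

HB.instance Definition _ := GRing.Zmodule_isComNzRing.Build (fps R)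
  fps_mulA fps_mulC fps_mul1 fps_mulDl fps_oner_neq0.
End FpsRing.

HB.instance Definition _ (R : comNzRingType) (V : lmodType R) :=
  GRing.Zmodule_isLmodule.Build (fps R) (fps V)
    (@fps_scaleA R V) (@fps_scale1 R V) (@fps_scaleDr R V) (@fps_scaleDl R V).

Section Star.
Variables (k : fieldType) (A : lmodType k).

(* The family m_0, m_1, m_2, .. with m_0 := m; the value mu 0 is not used. *)
Definition deformed (m : cochain A 2) (mu : nat -> cochain A 2) (n : nat) :
  cochain A 2 := if n is 0 then m else mu n.

(* The k[[h]]-bilinear extension to A[[h]] of
     u * v = m (u, v) + sum_(n >= 1) h^n mu_n (u, v)   (u, v in A):
   its coefficient of h^n is the sum of the (deformed m mu l) (u_i, v_j) over
   i + j + l = n.  A k[[h]]-bilinear map on A[[h]] is determined by its values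
   on A, since its value modulo h^N only depends on the arguments modulo h^N. *)
Definition star (m : cochain A 2) (mu : nat -> cochain A 2) (u v : fps A) :
  fps A :=
  fun n => \sum_(i < n.+1) \sum_(j < n.+1 | (i + j <= n)%N)
             deformed m mu (n - (i + j)) [tuple u i; v j].
End Star.

(* Main.v *)
Require Import Defs.
From HB Require Import structures.
From mathcomp Require Import all_boot all_order all_algebra.
From mathcomp Require Import boolp classical_sets functions.
From mathcomp Require Import zify.

Set Implicit Arguments.
Unset Strict Implicit.

Import GRing.Theory.
Local Open Scope ring_scope.

(** Write M_0 = m and M_l = mu_l for l >= 1.  On triples (x, y, z), the cochain
    circ M_p M_q is M_p(M_q(x, y), z) - M_p(x, M_q(y, z)) (circ2E), so the
    product is associative as soon as, for every n,

      sum_(p + q = n) circ M_p M_q = 0.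

    This is the Maurer-Cartan equation (maurer_cartan).  For n = 0 it is the
    associativity of m, for n = 1 it is the cocycle condition on mu_1.  For
    n >= 2 the terms with p = 0 or q = 0 add up to [m, mu_n] = hdiff m mu_n,
    and the other terms add up to -D_n, since 2 is invertible (obstructionE);
    so the equation reads hdiff m mu_n = D_n, which holds because
    mu_n = sigma D_n with D_n in the domain where sigma contracts hdiff m.
    The equation of order n does not use those of lower order: no induction on n
    is needed.

    To pass from these identities to power series, a series u is described
    modulo h^N by finite families (U_t) and (wt t) such that
    u = sum_t h^(wt t) U_t modulo h^N (expansion).  Such expansions are
    compatible with the action of k[[h]] (expansion_scale) and with the star
    product (expansion_star).  Both sides of an identity between iterated
    products thereby become finite sums over a product of index sets, and
    a reindexing compares them. *)

(** * Cauchy sums over a common range *)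

Section TruncatedSums.
Variable V : zmodType.

(** Substituting a = s in the condition t a = n.  When s >= N both sides vanish,
    because t s >= s >= N > n. *)
Lemma sum_ord_delta (N n : nat) (t : nat -> nat) (s : nat) (x : V) :
  (n < N)%N -> (forall a, a <= t a)%N ->
  \sum_(a < N) x *+ (s == a) *+ (t a == n) = x *+ (t s == n).
Proof.
move=> nN t_ge; have [sN|Ns] := ltnP s N.
  rewrite (bigD1 (Ordinal sN)) //= eqxx big1 ?addr0 // => a /negPf.
  by rewrite -val_eqE eq_sym /= => ->; rewrite mul0rn.
have /negPf-> : t s != n by have := t_ge s; lia.
rewrite big1 // => a _; have /negPf-> : s != a by have := ltn_ord a; lia.
by rewrite mul0rn.
Qed.

Lemma sum_ord_cauchy (N n : nat) (F : nat -> nat -> V) : (n < N)%N ->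
  \sum_(i < n.+1) F i (n - i)%N =
  \sum_(i < N) \sum_(j < N) F i j *+ (i + j == n)%N.
Proof.
move=> nN; rewrite (big_ord_widen N (fun i => F i (n - i)%N)) // big_mkcond /=.
apply: eq_bigr => i _; have [i_n|ni] := ltnP i n.+1; last first.
  by rewrite big1 // => j _; have /negPf-> : (i + j)%N != n by lia.
have nN' : (n - i < N)%N by lia.
rewrite (bigD1 (Ordinal nN')) //= subnKC // eqxx big1 ?addr0 // => j.
rewrite -val_eqE /= => ji.
by have /negPf-> : (i + j)%N != n by lia.
Qed.

Lemma sum_ord_cauchy3 (N n : nat) (F : nat -> nat -> nat -> V) : (n < N)%N ->
  \sum_(i < n.+1) \sum_(j < n.+1 | (i + j <= n)%N) F (n - (i + j))%N i j =
  \sum_(l < N) \sum_(i < N) \sum_(j < N) F l i j *+ (l + (i + j) == n)%N.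
Proof.
move=> nN; rewrite exchange_big.
rewrite (big_ord_widen N (fun i => \sum_(j < n.+1 | (i + j <= n)%N)
  F (n - (i + j))%N i j)) // big_mkcond /=.
apply: eq_bigr => i _; rewrite exchange_big /=.
transitivity (\sum_(j < N | (i + j <= n)%N) F (n - (i + j))%N i j).
  case: ltnP => [i_n|ni]; last by rewrite big_pred0 // => j; lia.
  rewrite (big_ord_widen_cond N (fun j => i + j <= n)%N
    (fun j => F (n - (i + j))%N i j)) //.
  by apply: eq_bigl => j; lia.
rewrite big_mkcond /=; apply: eq_bigr => j _; case: leqP => ijn; last first.
  by rewrite big1 // => l _; have /negPf-> : (l + (i + j))%N != n by lia.
have nN' : (n - (i + j) < N)%N by lia.
rewrite (bigD1 (Ordinal nN')) //= subnK // eqxx big1 ?addr0 // => l.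
rewrite -val_eqE /= => ln.
by have /negPf-> : (l + (i + j))%N != n by lia.
Qed.
End TruncatedSums.
Arguments sum_ord_delta [V N n] t [s] x _ _.

(** * Finite expansions of power series *)

(** The series u is sum_t h^(wt t) U_t modulo h^N. *)
Definition expansion (V : zmodType) (N : nat) (T : finType) (wt : T -> nat)
    (U : T -> V) (u : fps V) :=
  forall i, (i < N)%N -> u i = \sum_(t : T) U t *+ (wt t == i).

Lemma expansion_self (V : zmodType) (N : nat) (u : fps V) :
  expansion N (fun i : 'I_N => i) (fun i => u i) u.
Proof.
move=> i iN; rewrite (bigD1 (Ordinal iN)) //= eqxx big1 ?addr0 // => t.
by rewrite -val_eqE /= => /negPf->.
Qed.

Lemma expansion_scale (R : comNzRingType) (V : lmodType R) (N : nat)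
    (S T : finType) (wS : S -> nat) (wT : T -> nat) (a_ : S -> R) (U : T -> V)
    (a : fps R) (u : fps V) :
  expansion N wS a_ a -> expansion N wT U u ->
  expansion N (fun x : S * T => wS x.1 + wT x.2)%N
    (fun x => a_ x.1 *: U x.2) (a *: u).
Proof.
move=> aE uE n nN.
rewrite [LHS](sum_ord_cauchy (N := N) (fun i j => a i *: u j)) //.
rewrite -(pair_bigA _ (fun s t => (a_ s *: U t) *+ (wS s + wT t == n)%N)) /=.
transitivity (\sum_(i < N) \sum_s \sum_t
    a_ s *: U t *+ (wS s == i) *+ (i + wT t == n)%N).
  apply: eq_bigr => i _; rewrite aE //.
  transitivity (\sum_(j < N) \sum_s \sum_t
    a_ s *: U t *+ (wS s == i) *+ (wT t == j) *+ (i + j == n)%N).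
    apply: eq_bigr => j _; rewrite uE // scaler_suml -sumrMnl.
    apply: eq_bigr => s _; rewrite scaler_sumr -sumrMnl; apply: eq_bigr => t _.
    by rewrite -scalerMnr -scalerMnl.
  rewrite exchange_big; apply: eq_bigr => s _.
  rewrite exchange_big; apply: eq_bigr => t _.
  by rewrite (sum_ord_delta (fun j => i + j)%N) // => b; exact: leq_addl.
rewrite exchange_big; apply: eq_bigr => s _.
rewrite exchange_big; apply: eq_bigr => t _.
by rewrite (sum_ord_delta (fun i => i + wT t)%N) // => b; exact: leq_addr.
Qed.

(** * Cochains of degree two *)

Section BinaryCochains.
Variables (k : fieldType) (A : lmodType k).

Lemma cochain2_linearl (f : cochain A 2) y : linear (fun x => f [tuple x; y]).
Proof.
have /multilinearP fL := cochain_multilinear f.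
apply: eq_linear (fL [tuple 0; y] ord0) => x; congr (cochain_fun f _).
by apply/val_inj; rewrite /= enum_ordSl enum_ordSl enum_ord0.
Qed.

Lemma cochain2_linearr (f : cochain A 2) x : linear (fun y => f [tuple x; y]).
Proof.
have /multilinearP fL := cochain_multilinear f.
apply: eq_linear (fL [tuple x; 0] ord_max) => y; congr (cochain_fun f _).
by apply/val_inj; rewrite /= enum_ordSl enum_ordSl enum_ord0.
Qed.

Lemma cochain2Zl (f : cochain A 2) a x y :
  f [tuple a *: x; y] = a *: f [tuple x; y].
Proof.
pose g : {linear A -> A} := HB.pack (fun x => f [tuple x; y])
  (GRing.isLinear.Build _ _ _ _ _ (cochain2_linearl f y)).
by rewrite -[LHS]/(g _) linearZ.
Qed.

Lemma cochain2Zr (f : cochain A 2) a x y :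
  f [tuple x; a *: y] = a *: f [tuple x; y].
Proof.
pose g : {linear A -> A} := HB.pack (fun y => f [tuple x; y])
  (GRing.isLinear.Build _ _ _ _ _ (cochain2_linearr f x)).
by rewrite -[LHS]/(g _) linearZ.
Qed.

Lemma cochain2_suml (f : cochain A 2) (T : finType) (U : T -> A) (b : T -> nat) y :
  f [tuple \sum_t U t *+ b t; y] = \sum_t f [tuple U t; y] *+ b t.
Proof.
pose g : {linear A -> A} := HB.pack (fun x => f [tuple x; y])
  (GRing.isLinear.Build _ _ _ _ _ (cochain2_linearl f y)).
by rewrite -[LHS]/(g _) linear_sum; apply: eq_bigr => t _; rewrite linearMn.
Qed.

Lemma cochain2_sumr (f : cochain A 2) (T : finType) (U : T -> A) (b : T -> nat) x :
  f [tuple x; \sum_t U t *+ b t] = \sum_t f [tuple x; U t] *+ b t.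
Proof.
pose g : {linear A -> A} := HB.pack (fun y => f [tuple x; y])
  (GRing.isLinear.Build _ _ _ _ _ (cochain2_linearr f x)).
by rewrite -[LHS]/(g _) linear_sum; apply: eq_bigr => t _; rewrite linearMn.
Qed.

Lemma cochainDE n (f g : cochain A n) x : (f + g) x = f x + g x.
Proof. by []. Qed.

Lemma cochainZE n a (f : cochain A n) x : (a *: f) x = a *: f x.
Proof. by []. Qed.

Lemma cochain_sumE n (I : Type) (r : seq I) (P : pred I) (F : I -> cochain A n) x :
  (\sum_(i <- r | P i) F i) x = \sum_(i <- r | P i) F i x.
Proof. by elim/big_rec2: _ => // i y f _ <-. Qed.

(** circ f g is the mixed associator of f and g, and circ f f is the associator
    of f. *)
Lemma circ2E (f g : cochain A 2) x y z :
  circ f g [tuple x; y; z] =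
  f [tuple g [tuple x; y]; z] - f [tuple x; g [tuple y; z]].
Proof.
rewrite /circ !big_ord_recl big_ord0 addr0 cochainDE !cochainZE.
rewrite expr0 expr1 scale1r scaleN1r /= /circ_at_fun.
congr (f _ - f _); apply/val_inj; rewrite /= !enum_ordSl enum_ord0 /=.
  by congr [:: g _; _]; apply/val_inj; rewrite /= !enum_ordSl enum_ord0.
by congr [:: _; g _]; apply/val_inj; rewrite /= !enum_ordSl enum_ord0.
Qed.
End BinaryCochains.

(** * The star product *)

Section StarProduct.
Variables (k : fieldType) (A : lmodType k) (m : cochain A 2).
Variable (mu : nat -> cochain A 2).
Local Notation M := (deformed m mu).
Local Notation starm := (star m mu).

Lemma expansion_star (N : nat) (S T : finType) (wS : S -> nat) (wT : T -> nat)
    (U : S -> A) (V : T -> A) (u v : fps A) :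
  expansion N wS U u -> expansion N wT V v ->
  expansion N
    (fun x : 'I_N * (S * T) => x.1 + (wS x.2.1 + wT x.2.2))%N
    (fun x => M x.1 [tuple U x.2.1; V x.2.2]) (starm u v).
Proof.
move=> uE vE n nN.
rewrite [LHS](sum_ord_cauchy3 (N := N) (fun l i j => M l [tuple u i; v j])) //.
rewrite -(pair_bigA _ (fun (l : 'I_N) y =>
  M l [tuple U y.1; V y.2] *+ (l + (wS y.1 + wT y.2) == n)%N)) /=.
apply: eq_bigr => l _.
rewrite -(pair_bigA _ (fun s t =>
  M l [tuple U s; V t] *+ (l + (wS s + wT t) == n)%N)) /=.
transitivity (\sum_(i < N) \sum_s \sum_t
    M l [tuple U s; V t] *+ (wS s == i) *+ (l + (i + wT t) == n)%N).
  apply: eq_bigr => i _; rewrite uE //.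
  transitivity (\sum_(j < N) \sum_s \sum_t
    M l [tuple U s; V t] *+ (wS s == i) *+ (wT t == j) *+ (l + (i + j) == n)%N).
    apply: eq_bigr => j _; rewrite vE // cochain2_suml -sumrMnl.
    apply: eq_bigr => s _; rewrite cochain2_sumr -!sumrMnl.
    by apply: eq_bigr => t _; congr (_ *+ _); rewrite mulrnAC.
  rewrite exchange_big; apply: eq_bigr => s _.
  rewrite exchange_big; apply: eq_bigr => t _.
  by rewrite (sum_ord_delta (fun j => l + (i + j))%N) // => b; lia.
rewrite exchange_big; apply: eq_bigr => s _.
rewrite exchange_big; apply: eq_bigr => t _.
by rewrite (sum_ord_delta (fun i => l + (i + wT t))%N) // => b; lia.
Qed.

Lemma starDl u v w : starm (u + v) w = starm u w + starm v w.
Proof.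
apply/funext => n; rewrite -[RHS]/(starm u w n + starm v w n) -big_split /=.
apply: eq_bigr => i _; rewrite -big_split /=; apply: eq_bigr => j _.
by have := cochain2_linearl (M (n - (i + j))) (w j) 1 (u i) (v i); rewrite !scale1r.
Qed.

Lemma starDr u v w : starm u (v + w) = starm u v + starm u w.
Proof.
apply/funext => n; rewrite -[RHS]/(starm u v n + starm u w n) -big_split /=.
apply: eq_bigr => i _; rewrite -big_split /=; apply: eq_bigr => j _.
by have := cochain2_linearr (M (n - (i + j))) (u i) 1 (v j) (w j); rewrite !scale1r.
Qed.

Lemma starZl (a : fps k) (u v : fps A) : starm (a *: u) v = a *: starm u v.
Proof.
apply/funext => n; pose N := n.+1.
have [[aE uE] vE] := (@expansion_self _ N a, @expansion_self _ N u, @expansion_self _ N v).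
rewrite (expansion_star (expansion_scale aE uE) vE) //.
rewrite (expansion_scale aE (expansion_star uE vE)) //.
rewrite (reindex (fun x : 'I_N * ('I_N * ('I_N * 'I_N)) =>
  (x.2.1, ((x.1, x.2.2.1), x.2.2.2)))) /=; last first.
  by exists (fun x => (x.2.1.1, (x.1, (x.2.1.2, x.2.2))))
    => [[? [? [? ?]]]|[? [[? ?] ?]]].
apply: eq_bigr => x _; rewrite cochain2Zl; congr (_ *+ nat_of_bool (_ == _)); lia.
Qed.

Lemma starZr (a : fps k) (u v : fps A) : starm u (a *: v) = a *: starm u v.
Proof.
apply/funext => n; pose N := n.+1.
have [[aE uE] vE] := (@expansion_self _ N a, @expansion_self _ N u, @expansion_self _ N v).
rewrite (expansion_star uE (expansion_scale aE vE)) //.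
rewrite (expansion_scale aE (expansion_star uE vE)) //.
rewrite (reindex (fun x : 'I_N * ('I_N * ('I_N * 'I_N)) =>
  (x.2.1, (x.2.2.1, (x.1, x.2.2.2))))) /=; last first.
  by exists (fun x => (x.2.2.1, (x.1, (x.2.1, x.2.2.2)))) => -[? [? [? ?]]].
apply: eq_bigr => x _; rewrite cochain2Zr; congr (_ *+ nat_of_bool (_ == _)); lia.
Qed.

(** Modulo h^N, both triple products expand over the indices (a, b, c) of the
    coefficients of u, v, w and the orders (p, q) of the two cochains; for fixed
    (a, b, c) the difference is the Maurer-Cartan sum of order n - (a + b + c),
    evaluated at (u_a, v_b, w_c). *)
Lemma star_assoc :
  (forall n, \sum_(i < n.+1) circ (M i) (M (n - i)%N) = 0) -> associative starm.
Proof.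
move=> MC u v w; apply/funext => n; pose N := n.+1.
have [[uE vE] wE] := (@expansion_self _ N u, @expansion_self _ N v, @expansion_self _ N w).
rewrite (expansion_star uE (expansion_star vE wE)) //.
rewrite (expansion_star (expansion_star uE vE) wE) //.
pose I := 'I_N.
(* Both sums are brought to the index ((a, (b, c)), (p, q)). *)
rewrite (reindex (fun x : (I * (I * I)) * (I * I) =>
  (x.2.1, (x.1.1, (x.2.2, x.1.2))))) /=; last first.
  by exists (fun x => ((x.2.1, x.2.2.2), (x.1, x.2.2.1)))
    => [[[? [? ?]] [? ?]]|[? [? [? [? ?]]]]].
rewrite [RHS](reindex (fun x : (I * (I * I)) * (I * I) =>
  (x.2.1, ((x.2.2, (x.1.1, x.1.2.1)), x.1.2.2)))) /=; last first.
  by exists (fun x => ((x.2.1.2.1, (x.2.1.2.2, x.2.2)), (x.1, x.2.1.1)))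
    => [[[? [? ?]] [? ?]]|[? [[? [? ?]] ?]]].
apply/eqP; rewrite eq_sym -subr_eq0 -sumrB; apply/eqP.
rewrite -(pair_bigA _ (fun (y : I * (I * I)) (z : I * I) =>
    M z.1 [tuple M z.2 [tuple u y.1; v y.2.1]; w y.2.2] *+
      (z.1 + (z.2 + (y.1 + y.2.1) + y.2.2) == n)%N -
    M z.1 [tuple u y.1; M z.2 [tuple v y.2.1; w y.2.2]] *+
      (z.1 + (y.1 + (z.2 + (y.2.1 + y.2.2))) == n)%N)) /=.
apply: big1 => -[a [b c]] _ /=.
pose s := (a + b + c)%N.
transitivity (\sum_(z : I * I) circ (M z.1) (M z.2) [tuple u a; v b; w c]
   *+ (z.1 + z.2 + s == n)%N).
  apply: eq_bigr => z _; rewrite circ2E mulrnBl.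
  have -> : (z.1 + (z.2 + (a + b) + c))%N = (z.1 + z.2 + s)%N by rewrite /s; lia.
  by have -> : (z.1 + (a + (z.2 + (b + c))))%N = (z.1 + z.2 + s)%N by rewrite /s; lia.
rewrite -(pair_bigA _ (fun p q : I => circ (M p) (M q) [tuple u a; v b; w c]
   *+ (p + q + s == n)%N)) /=.
have [sn|ns] := leqP s n; last first.
  rewrite big1 // => p _; rewrite big1 // => q _.
  by have /negPf-> : (p + q + s)%N != n by lia.
transitivity (\sum_(p < N) \sum_(q < N) circ (M p) (M q) [tuple u a; v b; w c]
   *+ (p + q == n - s)%N).
  apply: eq_bigr => p _; apply: eq_bigr => q _; congr (_ *+ nat_of_bool _); lia.
rewrite -(sum_ord_cauchy (fun p q => circ (M p) (M q) [tuple u a; v b; w c])).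
  by rewrite -cochain_sumE MC.
by rewrite /N; lia.
Qed.

Lemma star_const (u v : A) n :
  starm (fps_const u) (fps_const v) n = M n [tuple u; v].
Proof.
rewrite /star (bigD1 ord0) //= (bigD1 ord0) //= addn0 subn0.
rewrite big1 ?addr0 => [|j]; last first.
  case/andP=> _; case: j => -[|j] //= _ _.
  by have := cochain2Zr (M (n - j.+1)) 0 u 0; rewrite !scale0r.
rewrite big1 ?addr0 // => -[[|i]] //= _ _; rewrite big1 // => j _.
by have := cochain2Zl (M (n - (i.+1 + j))) 0 0 (fps_const v j); rewrite !scale0r.
Qed.
End StarProduct.

(** * The Maurer-Cartan equation *)

Section MaurerCartan.
Variables (k : fieldType) (A : lmodType k) (m : cochain A 2).
Variable mu : nat -> cochain A 2.
Local Notation M := (deformed m mu).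

Lemma circ_assoc_eq0 : associative (fun u v : A => m [tuple u; v]) -> circ m m = 0.
Proof.
move=> mA; apply: cochainP => x.
case/tupleP: x => a x; case/tupleP: x => b x; case/tupleP: x => c x.
have -> : [tuple of a :: [tuple of b :: [tuple of c :: x]]] = [tuple a; b; c].
  by rewrite (tuple0 x); exact: val_inj.
by rewrite circ2E mA subrr.
Qed.

(** The two halves of the graded commutator contribute the same sum, by the
    symmetry i <-> n - i. *)
Lemma obstructionE n : (2 : k) != 0 ->
  obstruction mu n = - \sum_(1 <= i < n) circ (mu i) (mu (n - i)%N).
Proof.
move=> two0; rewrite /obstruction.
under eq_bigr do rewrite bracket2E.
rewrite big_split /= [X in _ + X]big_nat_rev /=.
rewrite (@eq_big_nat _ _ _ 1 n (fun i => circ (mu (n - (1 + n - i.+1))) (mu (1 + n - i.+1)))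
   (fun i => circ (mu i) (mu (n - i)))).
  by rewrite -mulr2n -scaler_nat scalerA mulNr mulVf // scaleN1r.
by move=> i /andP[i1 i_n]; congr (circ (mu _) (mu _)); lia.
Qed.

(** At order n >= 1 the Maurer-Cartan equation for the family M is
    hdiff m mu_n = D_n (with D_1 = 0); at order 0 it is the associativity of m. *)
Lemma maurer_cartan : (2 : k) != 0 ->
  associative (fun u v : A => m [tuple u; v]) ->
  hdiff m (mu 1) = 0 ->
  (forall n, (2 <= n)%N -> hdiff m (mu n) = obstruction mu n) ->
  forall n, \sum_(i < n.+1) circ (M i) (M (n - i)%N) = 0.
Proof.
move=> two0 mA d1 dn [|n]; first by rewrite big_ord1 /= circ_assoc_eq0.
have {d1 dn} : hdiff m (mu n.+1) = obstruction mu n.+1.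
  (* At order 1 the obstruction is an empty sum. *)
  case: n => [|n]; last exact: dn.
  by rewrite d1 obstructionE // big_geq // oppr0.
rewrite obstructionE // => /eqP; rewrite -addr_eq0 /hdiff bracket2E => /eqP dE.
rewrite big_ord_recl big_ord_recr /= subn0 subSS subnn addrA -[RHS]dE.
rewrite addrAC; congr (_ + _).
rewrite big_add1 /= big_mkord; apply: eq_bigr => i _.
(* M and mu agree away from the index 0. *)
have : (0 < n - i)%N by rewrite subn_gt0 ltn_ord.
by rewrite /= subSS; case: (n - i)%N.
Qed.
End MaurerCartan.

Unset Implicit Arguments.

Theorem mainTheorem1 (k : fieldType) (k_char0 : [pchar k] =i pred0)
  (A : lmodType k) (m : cochain A 2)
  (m_assoc : associative (fun u v : A => m [tuple u; v]))
  (m1 : cochain A 2) (m1_cocycle : hdiff m m1 = 0)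
  (D : {pred cochain A 3}) (D_subspace : submod_closed D)
  (D_cocycles : forall z, z \in D -> hdiff m z = 0)
  (* only the restriction of sigma to D matters *)
  (sigma : cochain A 3 -> cochain A 2)
  (sigma_linear : forall (a : k) (z w : cochain A 3), z \in D -> w \in D ->
     sigma (a *: z + w) = a *: sigma z + sigma w)
  (* the term sigma (d z) = sigma 0 = 0 is omitted *)
  (sigma_contraction : forall z, z \in D -> hdiff m (sigma z) = z)
  (mu : nat -> cochain A 2) (mu_1 : mu 1%N = m1)
  (mu_rec : forall n, (2 <= n)%N -> mu n = sigma (obstruction mu n))
  (D_obstruction : forall n, (2 <= n)%N -> obstruction mu n \in D) :
  [/\ bilinear_for *:%R *:%R (star m mu : fps A -> fps A -> fps A),
      forall u v : A, star m mu (fps_const u) (fps_const v) =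
        (fun n => if n is 0 then m [tuple u; v] else mu n [tuple u; v]) &
      associative (star m mu)].
Proof.
have two0 : (2 : k) != 0 by have /pcharf0P-> := k_char0.
have MC := maurer_cartan two0 m_assoc.
split.
- split=> [w a u v|u a v w]; first by rewrite starDl starZl.
  by rewrite starDr starZr.
- by move=> u v; apply/funext => n; rewrite star_const; case: n.
- apply/star_assoc/MC; first by rewrite mu_1.
  by move=> n n2; rewrite mu_rec // sigma_contraction // D_obstruction.
Qed.
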